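(* Suppose that the exact solution $(u,v)$ of the coupled nonlinear fractional Ginzburg-Landau problem (described in the context) is smooth enough, and let $\tau_0,h_0,C_*$ be the positive constants described in the context. Then the three-level linearized difference scheme (described in the context) is uniquely solvable, i.e. it has exactly one solution $(U^n,V^n)_{0\le n\le N}$, whenever $h=(b-a)/M<h_0$ and $\tau=T/N$ satisfies $$\tau<\min\left\{\tau_0,\ \frac{1}{|\gamma_1|+(|\kappa_1|+|\delta_1|)|C_*|^2},\ \frac{1}{|\gamma_2|+(|\kappa_2|+|\delta_2|)|C_*|^2}\right\}$$ (where $1/0$ is read as $+\infty$).
   Context: Continuous problem. Let $1<\alpha\le 2$, $T>0$, $a<b$, $i=\sqrt{-1}$, and let $\upsilon_1,\upsilon_2>0$ and $\eta_m,\kappa_m,\zeta_m,\delta_m,\beta_m,\gamma_m$ ($m=1,2$) be real constants. The complex-valued functions $u,v$ satisfy, for $x\in(a,b)$, $0<t<T$, $$u_t+(\upsilon_1+i\eta_1)(-\Delta)^{\alpha/2}u+\big((\kappa_1+i\zeta_1)|u|^2+(\delta_1+i\beta_1)|v|^2\big)u-\gamma_1u=0,$$ $$v_t+(\upsilon_2+i\eta_2)(-\Delta)^{\alpha/2}v+\big((\kappa_2+i\zeta_2)|u|^2+(\delta_2+i\beta_2)|v|^2\big)v-\gamma_2v=0,$$ with $u(x,0)=u_0(x)$, $v(x,0)=v_0(x)$ and homogeneous Dirichlet conditions $u=v=0$ at $x=a,b$; no distinction is made between the solution on $\mathbb R$ and the solution on $[a,b]$, i.e. $u,v$ are regarded as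 extended by zero outside $[a,b]$. $(-\Delta)^{\alpha/2}$ is the fractional Laplacian in $x$ on $\mathbb R$ (Fourier multiplier $|\xi|^\alpha$; $(-\Delta)^{\alpha/2}=-\partial_x^2$ if $\alpha=2$). ''Smooth enough'' means that $u,v$ have as many bounded continuous derivatives in $t$ and $x$ (the zero extensions, in $x\in\mathbb R$) as are needed for second-order consistency of the discretization; in particular in $x$ the functions are $C^5(\mathbb R)$ with derivatives up to order five in $L^1(\mathbb R)$. Grid. For positive integers $M,N$: $h=(b-a)/M$, $\tau=T/N$, $x_j=a+jh$, $t_n=n\tau$. For grid functions write $U^{\bar n}_j=\tfrac12(U^{n+1}_j+U^{n-1}_j)$, $\delta_tU^n_j=\frac{U^{n+1}_j-U^{n-1}_j}{2\tau}$. For $U=(U_0,\dots,U_M)$ with $U_0=U_M=0$: $\|U\|_\infty=\max_{1\le j\le M-1}|U_j|$ and $$\Delta_h^\alpha U_j=\frac1{h^\alpha}\sum_{k=1}^{M-1}c^\alpha_{j-k}U_k\ (1\le j\le M-1),\qquad c^\alpha_k=\frac{(-1)^k\Gamma(\alpha+1)}{\Gamma(\frac\alpha2-k+1)\Gamma(\frac\alpha2+k+1)},$$ with $1/\Gamma=0$ at the poles of $\Gamma$. Scheme. For $0<j<M$ and $1\le n\le N-1$: $$\delta_tU^n_j+(\upsilon_1+i\eta_1)\Delta_h^\alpha U^{\bar n}_j+\big((\kappa_1+i\zeta_1)|U^n_j|^2+(\delta_1+i\beta_1)|V^n_j|^2\big)U^{\bar n}_j-\gamma_1U^{\bar n}_j=0,$$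 $$\delta_tV^n_j+(\upsilon_2+i\eta_2)\Delta_h^\alpha V^{\bar n}_j+\big((\kappa_2+i\zeta_2)|U^n_j|^2+(\delta_2+i\beta_2)|V^n_j|^2\big)V^{\bar n}_j-\gamma_2V^{\bar n}_j=0,$$ with $U^0_j=u_0(x_j)$, $V^0_j=v_0(x_j)$ ($0<j<M$), $U^n_0=U^n_M=V^n_0=V^n_M=0$ ($0\le n\le N$), and first step, for $0<j<M$, $$U^1_j=U^0_j-\tau\Big((\upsilon_1+i\eta_1)\Delta_h^\alpha U^0_j+\big((\kappa_1+i\zeta_1)|U^0_j|^2+(\delta_1+i\beta_1)|V^0_j|^2\big)U^0_j-\gamma_1U^0_j\Big),$$ $$V^1_j=V^0_j-\tau\Big((\upsilon_2+i\eta_2)\Delta_h^\alpha V^0_j+\big((\kappa_2+i\zeta_2)|U^0_j|^2+(\delta_2+i\beta_2)|V^0_j|^2\big)V^0_j-\gamma_2V^0_j\Big).$$ Constants $\tau_0,h_0,C_*$. They are positive constants, independent of $\tau$ and $h$, such that for some $C_0>0$ independent of $\tau,h$ the following holds whenever $\tau<\tau_0$ and $h<h_0$: for each $1\le m\le N$, any grid functions $(U^n,V^n)_{0\le n\le m}$ satisfying the scheme up to time level $m$ (initial, boundary and first-step conditions, and the three-level equations for $1\le n\le m-1$) satisfy, for $1\le n\le m$, $\max_{1\le j\le M-1}|u(x_j,t_n)-U^n_j|\le C_0(\tau^2+h^2)$, $\max_{1\le j\le M-1}|v(x_j,t_n)-V^n_j|\le C_0(\tau^2+h^2)$, $\|U^n\|_\infty\le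 C_*$ and $\|V^n\|_\infty\le C_*$. *)

(* Defs.v *)
From HB Require Import structures.
From mathcomp Require Export all_boot all_order all_algebra.
From mathcomp Require Export complex.
From mathcomp Require Export all_classical all_reals all_analysis.
Export Order.TTheory GRing.Theory Num.Theory.
Export numFieldNormedType.Exports.

Set Implicit Arguments.
Unset Strict Implicit.
Unset Printing Implicit Defensive.

Local Open Scope classical_set_scope.
Local Open Scope complex_scope.
Local Open Scope ring_scope.

(* Real coefficients of one of the two coupled equations. *)
Record coeffs (R : realType) := Coeffs {
  upsilon : R; eta : R; kappa : R; zeta : R; delta : R; beta : R; gamma : R }.

(** Gamma function *)

Definition euler_Gamma {R : realType} (x : R) : R :=
  \int[lebesgue_measure]_(t in `]0, +oo[) (t `^ (x - 1) * expR (- t)).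

(* For x <= 0 this is the continuation by Gamma (x + 1) = x * Gamma x.  At the
   poles 0, -1, -2, ... the product vanishes; since 0^-1 = 0, both Gamma x and
   (Gamma x)^-1 are then 0, which gives the convention 1 / Gamma = 0 at poles. *)
Definition Gamma {R : realType} (x : R) : R :=
  if 0 < x then euler_Gamma x
  else let n := (Num.truncn (- x)).+1 in
       euler_Gamma (x + n%:R) / \prod_(i < n) (x + i%:R).

(** Continuous problem *)

Definition expi {R : realType} (theta : R) : R[i] := cos theta +i* sin theta.

Definition Cintegral {R : realType} (f : R -> R[i]) : R[i] :=
  (\int[lebesgue_measure]_x complex.Re (f x)) +i*
  (\int[lebesgue_measure]_x complex.Im (f x)).

Definition Cderive {R : realType} (f : R -> R[i]) (t : R) : R[i] :=
  derive1 (fun s => complex.Re (f s)) t +i* derive1 (fun s => complex.Im (f s)) t.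

Definition fourier {R : realType} (f : R -> R[i]) (xi : R) : R[i] :=
  Cintegral (fun x => f x * expi (- (xi * x))).

Definition fracLap {R : realType} (alpha : R) (f : R -> R[i]) (x : R) : R[i] :=
  ((2 * pi)^-1)%:C *
  Cintegral (fun xi => (`|xi| `^ alpha)%:C * fourier f xi * expi (xi * x)).

(* ((kappa + i zeta) |u|^2 + (delta + i beta) |v|^2) w - gamma w *)
Definition reaction {R : realType} (c : coeffs R) (u v w : R[i]) : R[i] :=
  ((kappa c +i* zeta c) * `|u| ^+ 2 + (delta c +i* beta c) * `|v| ^+ 2) * w
  - (gamma c)%:C * w.

Definition bounded_cont {R : realType} (D : set (R * R)) (f : R -> R -> R) : Prop :=
  {within D, continuous (fun p => f p.1 p.2)} /\
  exists K : R, forall x t, D (x, t) -> `|f x t| <= K.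

(* Three derivatives in t and five in x suffice for consistency of order
   tau^2 + h^2: the time regularity of the fractional Laplacian of a solution is
   inherited, through the equation, from that of its first time derivative. *)
Definition smooth_real {R : realType} (T : R) (f : R -> R -> R) : Prop :=
  [/\ forall k (x t : R), (k < 3)%N -> 0 < t < T -> derivable (derive1n k (f x)) t 1,
      forall k, (k <= 3)%N ->
        bounded_cont [set p | 0 < p.2 < T] (fun x t => derive1n k (f x) t),
      forall l (x t : R), (l < 5)%N -> 0 <= t <= T -> derivable (derive1n l (f ^~ t)) x 1,
      forall l, (l <= 5)%N ->
        bounded_cont [set p | 0 <= p.2 <= T] (fun x t => derive1n l (f ^~ t) x)
    & forall l (t : R), (l <= 5)%N -> 0 <= t <= T ->
        lebesgue_measure.-integrable setT (EFin \o derive1n l (f ^~ t))].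

Definition smooth {R : realType} (T : R) (u : R -> R -> R[i]) : Prop :=
  smooth_real T (fun x t => complex.Re (u x t)) /\
  smooth_real T (fun x t => complex.Im (u x t)).

(* w is the unknown of the equation with coefficients c (w = u or w = v); it is
   extended by zero outside ]a, b[, which includes the Dirichlet conditions. *)
Definition component_solution {R : realType} (alpha T a b : R) (c : coeffs R)
    (w0 : R -> R[i]) (u v w : R -> R -> R[i]) : Prop :=
  [/\ forall x t, a < x < b -> 0 < t < T ->
        Cderive (w x) t + (upsilon c +i* eta c) * fracLap alpha (w ^~ t) x
        + reaction c (u x t) (v x t) (w x t) = 0,
      forall x, a < x < b -> w x 0 = w0 x
    & forall x t, (x <= a) || (b <= x) -> 0 <= t <= T -> w x t = 0].

Definition exact_solution {R : realType} (alpha T a b : R) (c1 c2 : coeffs R)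
    (u0 v0 : R -> R[i]) (u v : R -> R -> R[i]) : Prop :=
  component_solution alpha T a b c1 u0 u v u /\
  component_solution alpha T a b c2 v0 u v v.

(** Difference scheme *)

Definition step {R : realType} (len : R) (K : nat) : R := len / K%:R.

Definition node {R : realType} (start s : R) (j : nat) : R := start + j%:R * s.

(* Space-time grid functions for time levels 0..m and space indices 0..M. *)
Definition gridfun (R : realType) (m M : nat) := 'M[R[i]]_(m.+1, M.+1).

(* Value at (n, j); only meaningful, and only used, for n <= m and j <= M. *)
Definition gval {R : realType} {m M : nat} (U : gridfun R m M) (n j : nat) : R[i] :=
  U (inord n) (inord j).

Definition fd_coeff {R : realType} (alpha : R) (k : int) : R :=
  (-1) ^ k * Gamma (alpha + 1) /
  (Gamma (alpha / 2 - k%:~R + 1) * Gamma (alpha / 2 + k%:~R + 1)).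

Definition discLap {R : realType} (alpha h : R) (M : nat) (w : nat -> R[i]) (j : nat) :
    R[i] :=
  ((h `^ alpha)^-1)%:C *
  \sum_(1 <= k < M) (fd_coeff alpha (j%:Z - k%:Z))%:C * w k.

Definition tavg {R : realType} {m M : nat} (U : gridfun R m M) (n j : nat) : R[i] :=
  (gval U n.+1 j + gval U n.-1 j) / 2.

Definition tdiff {R : realType} {m M : nat} (tau : R) (U : gridfun R m M) (n j : nat) :
    R[i] :=
  (gval U n.+1 j - gval U n.-1 j) / (2 * tau)%:C.

(* The scheme up to time level m for the component W (W = U or W = V). *)
Definition component_scheme {R : realType} (alpha a h tau : R) (c : coeffs R)
    (w0 : R -> R[i]) (m M : nat) (U V W : gridfun R m M) : Prop :=
  [/\ forall j, (0 < j < M)%N -> gval W 0 j = w0 (node a h j),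
      forall n, (n <= m)%N -> gval W n 0 = 0 /\ gval W n M = 0,
      forall j, (0 < j < M)%N ->
        gval W 1 j = gval W 0 j - tau%:C *
          ((upsilon c +i* eta c) * discLap alpha h M (gval W 0) j
           + reaction c (gval U 0 j) (gval V 0 j) (gval W 0 j))
    & forall n j, (0 < n < m)%N -> (0 < j < M)%N ->
        tdiff tau W n j
        + (upsilon c +i* eta c) * discLap alpha h M (tavg W n) j
        + reaction c (gval U n j) (gval V n j) (tavg W n j) = 0].

Definition scheme {R : realType} (alpha a h tau : R) (c1 c2 : coeffs R)
    (u0 v0 : R -> R[i]) (m M : nat) (U V : gridfun R m M) : Prop :=
  component_scheme alpha a h tau c1 u0 U V U /\
  component_scheme alpha a h tau c2 v0 U V V.

Definition maxnorm {R : realType} (M : nat) (w : nat -> R[i]) : R :=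
  \big[Num.max/0]_(1 <= j < M) ComplexField.Normc.normc (w j).

Definition convergence_constants {R : realType} (alpha T a b : R) (c1 c2 : coeffs R)
    (u0 v0 : R -> R[i]) (u v : R -> R -> R[i]) (tau0 h0 Cstar : R) : Prop :=
  exists2 C0 : R, 0 < C0 &
  forall M N : nat, (0 < M)%N -> (0 < N)%N ->
  let h := step (b - a) M in
  let tau := step T N in
  tau < tau0 -> h < h0 ->
  forall m : nat, (1 <= m <= N)%N ->
  forall U V : gridfun R m M, scheme alpha a h tau c1 c2 u0 v0 U V ->
  forall n : nat, (1 <= n <= m)%N ->
  [/\ maxnorm M (fun j => u (node a h j) (node 0 tau n) - gval U n j)
        <= C0 * (tau ^+ 2 + h ^+ 2),
      maxnorm M (fun j => v (node a h j) (node 0 tau n) - gval V n j)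
        <= C0 * (tau ^+ 2 + h ^+ 2),
      maxnorm M (gval U n) <= Cstar
    & maxnorm M (gval V n) <= Cstar].

(* 1 / (|gamma| + (|kappa| + |delta|) |C|^2) in the extended reals, where the
   library inverse satisfies 0^-1 = +oo. *)
Definition tau_bound {R : realType} (c : coeffs R) (C : R) : \bar R :=
  ((`|gamma c| + (`|kappa c| + `|delta c|) * `|C| ^+ 2)%:E^-1)%E.

(* Main.v *)
Require Import Defs.
From mathcomp Require Import measurable_realfun ring lra zify.

(** Each level of the scheme is a linear system, so the theorem says that its
    matrix is invertible at every level.

    At level n the unknown is taken to be the time average
    y = (W^{n+1} + W^{n-1}) / 2, for which the equation reads
    (1/tau + r_j) y_j + (upsilon + i eta) (Delta_h y)_j = W^{n-1}_j / tau, with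
    r_j the value of the reaction coefficient at (U^n_j, V^n_j).  If y is in
    the kernel, pair the equation with y and take real parts.  Since Delta_h is
    a real, symmetric and positive semidefinite matrix, the dispersive term
    i eta Delta_h disappears, the diffusion upsilon Delta_h contributes a
    nonnegative amount, and sum_j (1/tau + Re r_j) |y_j|^2 <= 0 remains.
    The step bound together with the a priori bound Cstar on the level n gives
    1/tau + Re r_j > 0 ([Re_reaction_coef_gt]), so y = 0 ([evolution_unitmx]).
    The bound Cstar is available for any discrete solution up to level n; so
    existence follows by extending a solution by one level at a time
    ([component_extend], [component_start]), uniqueness by comparing two
    solutions level by level ([component_unique]).

    Positive semidefiniteness of Delta_h is where the coefficients
    c_k = (-1)^k Gamma(alpha+1) / (Gamma(beta-k+1) Gamma(beta+k+1)), with
    beta = alpha/2, have to be understood.  The functional equation of Gamma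
    gives (k+1+beta) c_{k+1} = (k-beta) c_k, hence c_0 >= 0, c_k <= 0 for
    k >= 1, and the telescoped formula
    c_0/2 + c_1 + ... + c_K = - (K+1+beta) c_{K+1} / (2 beta) >= 0.
    So every finite section of the Toeplitz matrix (c_{j-k}) has nonpositive
    entries off the diagonal and nonnegative row sums, and such a symmetric
    matrix is positive semidefinite ([diag_dominant_psd]). *)

Set Implicit Arguments.
Unset Strict Implicit.
Unset Printing Implicit Defensive.

Local Open Scope classical_set_scope.
Local Open Scope complex_scope.
Local Open Scope ring_scope.

(** * The functional equation of the Gamma function *)

Section EulerGamma.
Context {R : realType}.
Implicit Types (x t a b : R).

Lemma powR_expN_le x : 0 < x ->
  exists K : R, forall t, 1 <= t -> t `^ x * expR (- t) <= K / t.
Proof.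
move=> x0; pose m := (Num.truncn x).+1; exists (m.+1`!%:R) => t t1.
have t0 : 0 < t by lra.
have tx : t `^ x <= t ^+ m.
  rewrite -powR_mulrn; last lra.
  apply: ler_powR => //; apply: ltW; rewrite /m.
  by have /andP[_] := truncn_itv (ltW x0).
rewrite expRN ler_pdivrMr ?expR_gt0// mulrAC ler_pdivlMr//.
have tm : t ^+ m.+1 <= m.+1`!%:R * expR t.
  rewrite -ler_pdivrMl ?ltr0n ?fact_gt0//.
  have := @expR_ge1Dxn _ t m (ltW t0); rewrite mulrC; lra.
by apply: le_trans tm; rewrite exprSr ler_pM2r.
Qed.

Lemma euler_Gamma_ge0 x : 0 <= euler_Gamma x.
Proof. by apply: Rintegral_ge0 => t _; rewrite mulr_ge0 ?powR_ge0 ?expR_ge0. Qed.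

Lemma is_derive_expN t : is_derive t 1 (fun s : R => expR (- s)) (- expR (- t)).
Proof.
have h : is_derive t 1 (fun s : R => expR (- s)) (expR (- t) * (- 1)).
  exact: is_derive1_comp.
by apply: is_derive_eq; rewrite mulrN1.
Qed.

Lemma within_powR_expN x a b : 0 < a ->
  {within `[a, b], continuous (fun t : R => t `^ x * expR (- t))}.
Proof.
move=> a0; apply: derivable_within_continuous => t.
rewrite in_itv/= => /andP[at_ _]; apply: derivableM.
  by apply: derivable_powR; rewrite in_itv/= andbT (lt_le_trans a0).
by have [] := is_derive_expN t.
Qed.

Lemma integral_powR_expN_by_parts x a b : 0 < a -> a < b ->
  (\int[lebesgue_measure]_(t in `[a, b]) (x * (t `^ (x - 1) * expR (- t)))%:E =
   \int[lebesgue_measure]_(t in `[a, b]) (t `^ x * expR (- t))%:E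
   + (b `^ x * expR (- b) - a `^ x * expR (- a))%:E)%E.
Proof.
move=> a0 ab.
pose F t := t `^ x * expR (- t).
pose g t := x * (t `^ (x - 1) * expR (- t)).
have dF t : 0 < t -> is_derive t 1 F (g t - F t).
  move=> t0.
  apply: (is_derive_eq (is_deriveM (is_derive1_powR x t0) (is_derive_expN t))).
  by rewrite /g /F /GRing.scale/=; ring.
have cF : {within `[a, b], continuous F} by exact: within_powR_expN.
have cg : {within `[a, b], continuous g}.
  move=> /= t; apply: cvgM; first exact: cvg_cst.
  exact: within_powR_expN.
have ctsF t : 0 < t -> {for t, continuous F}.
  move=> t0; have [+ _] := dF t t0.
  by move=> /derivable1_diffP/differentiable_continuous.
have iF : lebesgue_measure.-integrable `[a, b] (EFin \o F).
  by apply: continuous_compact_integrable => //; exact: segment_compact.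
have ig : lebesgue_measure.-integrable `[a, b] (EFin \o g).
  by apply: continuous_compact_integrable => //; exact: segment_compact.
have ftc : (\int[lebesgue_measure]_(t in `[a, b]) (g t - F t)%:E
            = (F b)%:E - (F a)%:E)%E.
  apply: (@continuous_FTC2 R (fun t => g t - F t) F a b ab).
  - by move=> t; apply: cvgB; [exact: cg | exact: cF].
  - split.
    + move=> t; rewrite in_itv/= => /andP[at_ _].
      by have [] := dF t (lt_trans a0 at_).
    + by apply: cvg_at_right_filter; exact: ctsF.
    + by apply: cvg_at_left_filter; exact: ctsF (lt_trans a0 ab).
  - move=> t; rewrite in_itv/= => /andP[at_ _]; rewrite derive1E.
    by have [_ ->] := dF t (lt_trans a0 at_).
rewrite EFinB -ftc -/F.
have -> : (\int[lebesgue_measure]_(t in `[a, b]) (g t - F t)%:E =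
   \int[lebesgue_measure]_(t in `[a, b]) (g t)%:E
   - \int[lebesgue_measure]_(t in `[a, b]) (F t)%:E)%E.
  by under eq_integral do rewrite EFinB; rewrite integralB.
by rewrite addeC subeK//; exact: integrable_fin_num.
Qed.

Let inv_natSS_cvg0 : (n.+2%:R : R)^-1 @[n --> \oo] --> (0 : R).
Proof. by have := @cvg_harmonic R; rewrite -cvg_shiftS; exact. Qed.

Lemma powR_expN_boundary_cvg0 x : 0 < x ->
  n.+2%:R `^ x * expR (- n.+2%:R) - n.+2%:R^-1 `^ x * expR (- n.+2%:R^-1)
    @[n --> \oo] --> (0 : R).
Proof.
move=> x0; have [K hK] := powR_expN_le x0.
rewrite -[0](subr0 (0 : R)); apply: cvgB.
  apply: (@squeeze_cvgr _ _ _ _ (fun=> 0) (fun n => K * n.+2%:R^-1)).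
  - by near=> n; rewrite mulr_ge0 ?powR_ge0 ?expR_ge0//= hK// ler1n.
  - exact: cvg_cst.
  - by rewrite -[0](mulr0 K); apply: cvgM => //; exact: cvg_cst.
apply: (@squeeze_cvgr _ _ _ _ (fun=> 0) (fun n => n.+2%:R^-1 `^ x)).
- by near=> n; rewrite mulr_ge0 ?powR_ge0 ?expR_ge0//= ler_piMr ?powR_ge0.
- exact: cvg_cst.
- by have /cvg_at_rightP := powR_cvg0 x0; apply.
Unshelve. all: by end_near.
Qed.

Lemma ge0_integral_exhaustion (f : R -> R) :
  measurable_fun setT f -> (forall t, 0 <= f t) ->
  (\int[lebesgue_measure]_(t in `[(n.+2%:R^-1)%R, n.+2%:R%R]) (f t)%:E)%E
    @[n --> \oo] --> (\int[lebesgue_measure]_(t in `]0%R, +oo[) (f t)%:E)%E.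
Proof.
move=> mf f0.
pose D n := `[(n.+2%:R : R)^-1, n.+2%:R]%classic.
have <- : \bigcup_n D n = `]0, +oo[%classic.
  apply/seteqP; split => t /=.
    move=> [n _]; rewrite /D/= !in_itv/= => /andP[h _].
    by rewrite andbT (lt_le_trans _ h)// invr_gt0 ltr0n.
  rewrite in_itv/= andbT => t0.
  exists (maxn (Num.truncn t) (Num.truncn t^-1)) => //; rewrite /D/= in_itv/=.
  have ti0 : 0 <= t^-1 by rewrite invr_ge0 ltW.
  have [/andP[_ h1] /andP[_ h2]] := (truncn_itv (ltW t0), truncn_itv ti0).
  apply/andP; split.
    rewrite -[leRHS]invrK lef_pV2 ?posrE ?invr_gt0 ?ltr0n//.
    apply: ltW; apply: lt_le_trans h2 _.
    by rewrite ler_nat ltnS leqW// leq_maxr.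
  apply: ltW; apply: lt_le_trans h1 _.
  by rewrite ler_nat ltnS leqW// leq_maxl.
apply: ge0_nondecreasing_set_cvg_integral => //.
- move=> n m nm; apply/subsetPset => t; rewrite /D/= !in_itv/= => /andP[h1 h2].
  apply/andP; split.
    by rewrite (le_trans _ h1)// lef_pV2 ?posrE ?ltr0n// ler_nat.
  by rewrite (le_trans h2)// ler_nat.
- by move=> n; apply/measurable_EFinP; exact: measurable_funS mf.
- by move=> n t _; rewrite lee_fin.
Qed.

Lemma measurable_powR_expN x :
  measurable_fun setT (fun t : R => t `^ x * expR (- t)).
Proof.
apply: measurable_funM; first exact: measurable_powR.
by apply: measurableT_comp => //; exact: measurable_funN.
Qed.

(** Integration by parts on [1/n, n], followed by monotone convergence, gives
    the identity between the integrals as extended reals; it passes to their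
    finite parts without any integrability, because x > 0 maps the infinite
    value to itself and the finite part of that value is 0. *)
Lemma euler_GammaD1 x : 0 < x -> euler_Gamma (x + 1) = x * euler_Gamma x.
Proof.
move=> x0; rewrite /euler_Gamma addrK /Rintegral.
pose g t := t `^ (x - 1) * expR (- t).
have g0 t : 0 <= g t by rewrite mulr_ge0 ?powR_ge0 ?expR_ge0.
have mg : measurable_fun setT g by exact: measurable_powR_expN.
have cg := ge0_integral_exhaustion (measurable_funM (measurable_cst x) mg)
             (fun t => mulr_ge0 (ltW x0) (g0 t)).
have cF := ge0_integral_exhaustion (measurable_powR_expN x)
             (fun t => mulr_ge0 (powR_ge0 t x) (expR_ge0 (- t))).
have cB : (n.+2%:R `^ x * expR (- n.+2%:R)
           - n.+2%:R^-1 `^ x * expR (- n.+2%:R^-1))%:E @[n --> \oo] --> (0 : R)%:E.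
  by apply: cvg_EFin; [apply: nearW | exact: powR_expN_boundary_cvg0].
have cS := cvgeD
  (fin_num_adde_defl _ (erefl true : (0 : R)%:E \is a fin_num)) cF cB.
have <- : (\int[lebesgue_measure]_(t in `]0%R, +oo[) (x * g t)%:E =
           \int[lebesgue_measure]_(t in `]0%R, +oo[) (t `^ x * expR (- t))%:E)%E.
  rewrite -[RHS]adde0.
  apply: (cvg_unique (@ereal_hausdorff R) cg).
  rewrite /=; apply: cvg_trans (cS _).
  apply: near_eq_cvg; near=> n.
  rewrite integral_powR_expN_by_parts ?invr_gt0 ?ltr0n//.
  by rewrite (@lt_trans _ _ 1)// ?invf_lt1 ?ltr0n// ltr1n.
have -> : (\int[lebesgue_measure]_(t in `]0%R, +oo[) (x * g t)%:E =
           x%:E * \int[lebesgue_measure]_(t in `]0%R, +oo[) (g t)%:E)%E.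
  under eq_integral do rewrite EFinM.
  rewrite (@ge0_integralZl _ _ _ lebesgue_measure _ _ (EFin \o g)) => //.
  - by apply/measurable_EFinP; exact: measurable_funS mg.
  - by move=> t _; rewrite lee_fin.
  - by rewrite lee_fin ltW.
rewrite -/g; move: (\int[_]_(_ in _) _)%E => [r| |]//=.
- by rewrite gt0_muley ?lte_fin//= mulr0.
- by rewrite gt0_muleNy ?lte_fin//= mulr0.
Unshelve. all: by end_near.
Qed.

(** In terms of 1 / Gamma the functional equation has no exceptions: at the
    poles 0, -1, -2, ... both sides vanish. *)
Lemma invr_Gamma (z : R) : (Gamma z)^-1 = z / Gamma (z + 1).
Proof.
have [z0|z0] := ltP 0 z.
  rewrite /Gamma z0 ifT; last by rewrite addr_gt0.
  by rewrite euler_GammaD1// invfM mulrA divff ?mul1r// gt_eqF.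
suff -> : Gamma z = Gamma (z + 1) / z by rewrite invfM invrK mulrC.
have [z1|z1] := ltP (-1) z.
  have z10 : 0 < z + 1 by lra.
  rewrite /Gamma ltNge z0/= z10; have -> : Num.truncn (- z) = 0%N.
    by apply: truncn_def; apply/andP; split; lra.
  by rewrite big_ord_recl big_ord0 mulr1 addr0.
have z10 : z + 1 <= 0 by lra.
rewrite /Gamma !ltNge z0 z10/=.
have h : 0 <= - (z + 1) by lra.
set m := Num.truncn (- (z + 1)).
have -> : Num.truncn (- z) = m.+1.
  have /andP[h1 h2] := truncn_itv h; apply: truncn_def.
  rewrite -!(natr1 m.+1) -/m in h1 h2 *; rewrite -(natr1 m) in h2 *.
  by apply/andP; split; lra.
have -> : z + m.+2%:R = z + 1 + m.+1%:R by rewrite -(natr1 m.+1); ring.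
have -> : \prod_(i < m.+2) (z + i%:R) = z * \prod_(i < m.+1) (z + 1 + i%:R).
  rewrite big_ord_recl addr0; congr (_ * _); apply: eq_bigr => i _.
  by rewrite lift0 -(natr1 i); ring.
by rewrite invfM mulrA mulrAC.
Qed.

End EulerGamma.

(** * The coefficients of the discrete fractional Laplacian *)

Lemma fd_coeff_abs (R : realType) (alpha : R) (k : int) :
  fd_coeff alpha k = fd_coeff alpha `|k|%N.
Proof.
case: (intP k) => // n.
rewrite abszN absz_nat /fd_coeff.
have -> : ((-1) ^ (- n.+1%:Z) : R) = (-1) ^ n.+1%:Z.
  by rewrite -exprnN -exprVn invrN1.
by rewrite mulrNz opprK; congr (_ / _); rewrite mulrC.
Qed.

Section FdCoeff.
Context {R : realType} (alpha : R) (halpha : 1 < alpha <= 2).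
Let beta := alpha / 2.
Let c (k : nat) : R := fd_coeff alpha k.

Let beta_gt0 : 0 < beta.
Proof. by have /andP[? ?] := halpha; rewrite /beta; lra. Qed.

Let beta_le1 : beta <= 1.
Proof. by have /andP[? ?] := halpha; rewrite /beta; lra. Qed.

Lemma fd_coeff_rec k : (k.+1%:R + beta) * c k.+1 = (k%:R - beta) * c k.
Proof.
rewrite /c /fd_coeff -/beta -!pmulrn !invfM.
have E1 : (Gamma (beta - k.+1%:R + 1))^-1
    = (beta - k%:R) * (Gamma (beta - k%:R + 1))^-1.
  by rewrite invr_Gamma -natr1; congr (_ / Gamma _); ring.
have E2 : (Gamma (beta + k%:R + 1))^-1
    = (k.+1%:R + beta) * (Gamma (beta + k.+1%:R + 1))^-1.
  by rewrite invr_Gamma -natr1; congr (_ / Gamma _); ring.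
by rewrite E1 E2 -!exprnP exprS; ring.
Qed.

Lemma fd_coeff0_ge0 : 0 <= c 0.
Proof.
have Gp x : 0 < x -> 0 <= Gamma x by move=> x0; rewrite /Gamma x0 euler_Gamma_ge0.
rewrite /c /fd_coeff expr0z mul1r subr0 addr0 -/beta.
have b0 := beta_gt0; have /andP[a1 _] := halpha.
by apply: divr_ge0; [apply: Gp; lra | apply: mulr_ge0; apply: Gp; lra].
Qed.

(** The factor k - beta of the recurrence is negative for k = 0 only, because
    0 < beta <= 1. *)
Lemma fd_coeffS_le0 k : c k.+1 <= 0.
Proof.
have b0 := beta_gt0; have b1 := beta_le1; have c0 := fd_coeff0_ge0.
elim: k => [|k IH].
  have := fd_coeff_rec 0; have := ler_wpM2l (ltW b0) c0; nra.
have := fd_coeff_rec k.+1; rewrite -(natr1 k.+1) -(natr1 k).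
have : 0 <= k%:R :> R by [].
move: (k%:R) => K K0 E.
rewrite -(pmulr_rle0 _ (_ : 0 < K + 1 + 1 + beta)) ?E; last lra.
by rewrite mulr_ge0_le0//; lra.
Qed.

(** Telescoping: the recurrence says that
    (k+1+beta) c_{k+1} - (k+beta) c_k = - 2 beta c_k. *)
Lemma fd_coeff_sum K :
  c 0 / 2 + \sum_(k < K) c k.+1 = - ((K.+1%:R + beta) * c K.+1) / (2 * beta).
Proof.
have b0 := beta_gt0.
elim: K => [|K IH].
  by rewrite big_ord0 fd_coeff_rec; field; lra.
by rewrite big_ord_recr/= addrA IH (fd_coeff_rec K.+1) -natr1; field; lra.
Qed.

Lemma fd_coeff_sum_ge0 K : 0 <= c 0 / 2 + \sum_(k < K) c k.+1.
Proof.
have b0 := beta_gt0.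
rewrite fd_coeff_sum divr_ge0//; last by rewrite mulr_ge0// ltW.
by rewrite oppr_ge0 mulr_ge0_le0 ?fd_coeffS_le0// addr_ge0// ltW.
Qed.

End FdCoeff.

(** * Positive semidefiniteness *)

(** Row j of the section collects c_0 and the one-sided sums of lengths j and
    m - 1 - j; half of c_0 goes to each. *)
Lemma toeplitz_row_ge0 (R : realFieldType) (c : nat -> R) m (j : 'I_m) :
  (forall n, 0 <= c 0 / 2 + \sum_(i < n) c i.+1) ->
  0 <= \sum_(k < m) c `|j%:Z - k%:Z|%N.
Proof.
move=> hc; case: j => j jm /=.
have [n ->] : exists n, (m = j + n.+1)%N by exists (m - j.+1)%N; lia.
rewrite big_split_ord/= big_ord_recl/=.
have -> : \sum_(k < j) c `|j%:Z - k%:Z|%N = \sum_(i < j) c i.+1.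
  rewrite (reindex_inj rev_ord_inj)/=; apply: eq_bigr => i _; congr c.
  by have := ltn_ord i; lia.
have -> : \sum_(k < n) c `|j%:Z - (j + bump 0 k)%:Z|%N = \sum_(i < n) c i.+1.
  by apply: eq_bigr => i _; congr c; rewrite /bump; lia.
have -> : `|j%:Z - (j + 0)%:Z|%N = 0%N by lia.
by have := hc j; have := hc n; lra.
Qed.

(** Off the diagonal a_ij <= 0, so a_ij p_i p_j >= a_ij (p_i^2 + p_j^2) / 2;
    after summation the right-hand side only involves the row sums. *)
Lemma diag_dominant_psd (R : realFieldType) m (a : 'M[R]_m) (p : 'I_m -> R) :
  (forall i j, a i j = a j i) -> (forall i j, i != j -> a i j <= 0) ->
  (forall i, 0 <= \sum_j a i j) ->
  0 <= \sum_i \sum_j p i * a i j * p j.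
Proof.
move=> asym aoff arow.
have young : \sum_i \sum_j (a i j * p i ^+ 2 / 2 + a i j * p j ^+ 2 / 2)
    <= \sum_i \sum_j p i * a i j * p j.
  apply: ler_sum => i _; apply: ler_sum => j _.
  have [->|ij] := eqVneq i j.
    by rewrite le_eqVlt; apply/orP; left; apply/eqP; field.
  have := aoff _ _ ij; have := sqr_ge0 (p i - p j).
  by move: (a i j) (p i) (p j) => *; nra.
apply: le_trans young.
under eq_bigr do rewrite big_split/=.
rewrite big_split/= [X in _ + X]exchange_big/=.
have rows : 0 <= \sum_i \sum_j a i j * p i ^+ 2 / 2.
  apply: sumr_ge0 => i _; rewrite -mulr_suml -mulr_suml.
  by rewrite divr_ge0// mulr_ge0 ?sqr_ge0 ?arow.
rewrite addr_ge0//; under eq_bigr do under eq_bigr do rewrite asym.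
exact: rows.
Qed.

Section DiscreteLaplacian.
Context {R : realType}.
Implicit Types alpha h : R.

Definition discLap_mx alpha h m : 'M[R]_m :=
  \matrix_(i, j) ((h `^ alpha)^-1 * fd_coeff alpha (i%:Z - j%:Z)).

Lemma discLap_mx_sym alpha h m i j :
  discLap_mx alpha h m i j = discLap_mx alpha h m j i.
Proof. by rewrite !mxE fd_coeff_abs [in RHS]fd_coeff_abs distnC. Qed.

Lemma discLap_mx_psd alpha h m (p : 'I_m -> R) : 1 < alpha <= 2 ->
  0 <= \sum_i \sum_j p i * discLap_mx alpha h m i j * p j.
Proof.
move=> ha; have h0 : 0 <= (h `^ alpha)^-1 by rewrite invr_ge0 powR_ge0.
apply: diag_dominant_psd; first exact: discLap_mx_sym.
  move=> i j ij; rewrite mxE mulr_ge0_le0// fd_coeff_abs.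
  have : (0 < `|i%:Z - j%:Z|)%N by move: ij; rewrite -val_eqE/=; lia.
  by case: `|_|%N => // n _; exact: fd_coeffS_le0.
move=> i; under eq_bigr do rewrite mxE fd_coeff_abs.
rewrite -mulr_sumr mulr_ge0//.
apply: (toeplitz_row_ge0 (c := fun k : nat => fd_coeff alpha k)) => n.
exact: fd_coeff_sum_ge0.
Qed.

Lemma discLapE alpha h m (y : nat -> R[i]) (i : 'I_m) :
  discLap alpha h m.+1 y i.+1 = \sum_j (discLap_mx alpha h m i j)%:C * y j.+1.
Proof.
rewrite /discLap big_add1 big_mkord mulr_sumr; apply: eq_bigr => j _.
have -> : i.+1%:Z - j.+1%:Z = i%:Z - j%:Z by lia.
by rewrite mxE mulrA -rmorphM.
Qed.

Lemma eq_discLap alpha h M (w w' : nat -> R[i]) j :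
  (forall k, (0 < k < M)%N -> w k = w' k) ->
  discLap alpha h M w j = discLap alpha h M w' j.
Proof. by move=> H; congr (_ * _); apply: eq_big_nat => k kM; rewrite H. Qed.

End DiscreteLaplacian.

(** * The linear system of one level *)

Section Evolution.
Context {R : realType}.

Lemma ReD (x y : R[i]) : complex.Re (x + y) = complex.Re x + complex.Re y.
Proof. by case: x y => [? ?] [? ?]. Qed.

Lemma ImD (x y : R[i]) : complex.Im (x + y) = complex.Im x + complex.Im y.
Proof. by case: x y => [? ?] [? ?]. Qed.

Lemma Re_sum m (F : 'I_m -> R[i]) :
  complex.Re (\sum_i F i) = \sum_i complex.Re (F i).
Proof. exact: (big_morph _ ReD). Qed.

Lemma Im_sum m (F : 'I_m -> R[i]) :
  complex.Im (\sum_i F i) = \sum_i complex.Im (F i).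
Proof. exact: (big_morph _ ImD). Qed.

Definition evolution_mx m (a : 'M[R]_m) (d : 'I_m -> R[i]) (l : R[i]) : 'M[R[i]]_m :=
  \matrix_(i, j) (d i *+ (i == j) + l * (a i j)%:C).

(** For v in the kernel, the real part of the equation paired with v reads
    sum_j Re d_j |v_j|^2 + Re l (a v, v) = 0: the part of l that is imaginary
    drops out because a is real and symmetric. *)
Lemma evolution_unitmx m (a : 'M[R]_m) (d : 'I_m -> R[i]) (l : R[i]) :
  (forall i j, a i j = a j i) ->
  (forall p : 'I_m -> R, 0 <= \sum_i \sum_j p i * a i j * p j) ->
  0 <= complex.Re l -> (forall i, 0 < complex.Re (d i)) ->
  evolution_mx a d l \in unitmx.
Proof.
move=> asym apos l0 d0; rewrite unitmxE unitfE; apply/negP => /det0P [v v0 vS].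
pose p i := complex.Re (v 0 i); pose q i := complex.Im (v 0 i).
pose P j := \sum_i p i * a i j; pose Q j := \sum_i q i * a i j.
have vE j : v 0 j * d j + l * (P j +i* Q j) = 0.
  have /matrixP/(_ 0 j) := vS; rewrite !mxE => <-.
  under [RHS]eq_bigr do rewrite mxE mulrDr.
  rewrite big_split/= (bigD1 j)//= eqxx mulr1n big1 ?addr0; last first.
    by move=> i /negbTE ->; rewrite mulr0n mulr0.
  congr (_ + _).
  transitivity (l * \sum_i (v 0 i * (a i j)%:C)); last first.
    by rewrite mulr_sumr; apply: eq_bigr => i _; rewrite mulrCA.
  congr (_ * _); apply/eqP; rewrite eq_complex Re_sum Im_sum /=.
  apply/andP; split; apply/eqP; apply: eq_bigr => i _; rewrite /p /q.
    by case: (v 0 i) => x y /=; ring.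
  by case: (v 0 i) => x y /=; ring.
have E j : complex.Re (d j) * (p j ^+ 2 + q j ^+ 2)
    + complex.Re l * (p j * P j + q j * Q j)
    + complex.Im l * (q j * P j - p j * Q j) = 0.
  move: (vE j); rewrite /p /q; move: (P j) (Q j).
  case: (v 0 j) (d j) (l) => [x y] [dx dy] [lx ly] X Y [].
  move=> /= e1 e2.
  transitivity (x * (x * dx - y * dy + (lx * X - ly * Y))
                + y * (x * dy + y * dx + (lx * Y + ly * X))); first ring.
  by rewrite e1 e2 !mulr0 addr0.
have skew : \sum_j (q j * P j - p j * Q j) = 0.
  rewrite sumrB; apply/eqP; rewrite subr_eq0; apply/eqP.
  under eq_bigr do rewrite mulr_sumr; under [RHS]eq_bigr do rewrite mulr_sumr.
  rewrite exchange_big/=; apply: eq_bigr => i _; apply: eq_bigr => j _.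
  by rewrite asym; ring.
have energy : \sum_j (complex.Re (d j) * (p j ^+ 2 + q j ^+ 2))
    + complex.Re l * \sum_j (p j * P j + q j * Q j) = 0.
  have : \sum_j (complex.Re (d j) * (p j ^+ 2 + q j ^+ 2)
      + complex.Re l * (p j * P j + q j * Q j)
      + complex.Im l * (q j * P j - p j * Q j)) = 0.
    by apply: big1 => j _; exact: E.
  by rewrite 2!big_split/= -[X in _ + X]mulr_sumr skew mulr0 addr0 -mulr_sumr.
have PQ : 0 <= \sum_j (p j * P j + q j * Q j).
  rewrite big_split/= addr_ge0//.
    have := apos p; rewrite exchange_big/=.
    by under eq_bigr do rewrite -mulr_suml mulrC.
  have := apos q; rewrite exchange_big/=.
  by under eq_bigr do rewrite -mulr_suml mulrC.
have pq0 j : 0 <= complex.Re (d j) * (p j ^+ 2 + q j ^+ 2).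
  by rewrite mulr_ge0 ?addr_ge0 ?sqr_ge0// ltW.
move/eqP: energy; rewrite paddr_eq0 ?sumr_ge0 ?mulr_ge0// => /andP[+ _].
rewrite psumr_eq0// => /allP H.
case/negP: v0; apply/eqP/rowP => j; rewrite mxE; apply/eqP.
have := H j (mem_index_enum j); rewrite implyTb mulf_eq0 gt_eqF//=.
rewrite paddr_eq0 ?sqr_ge0// !sqrf_eq0 /p /q => /andP[/eqP p0 /eqP q0].
by rewrite eq_complex p0 q0 !eqxx.
Qed.

(** In the time average y = (w + p) / 2 the equation becomes
    (1/tau + r) y + l Delta_h y = p / tau. *)
Lemma linear_step (alpha h tau : R) (M : nat) (l : R[i]) (p r : nat -> R[i])
  (eqn := fun w : nat -> R[i] => forall j, (0 < j < M)%N ->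
     (w j - p j) / (2 * tau)%:C
     + l * discLap alpha h M (fun k => (w k + p k) / 2) j
     + r j * ((w j + p j) / 2) = 0) :
  1 < alpha <= 2 -> 0 < tau -> 0 <= complex.Re l ->
  (forall j, (0 < j < M)%N -> 0 < tau^-1 + complex.Re (r j)) ->
  (exists w, eqn w) /\
  (forall w w', eqn w -> eqn w' -> forall j, (0 < j < M)%N -> w j = w' j).
Proof.
move=> ha tau0 l0 r0; rewrite {}/eqn.
case: M r0 => [|m] r0.
  by split=> [|w w' _ _ j]; [exists (fun=> 0) => j|]; rewrite ltn0 andbF.
pose S := evolution_mx (discLap_mx alpha h m) (fun i => tau^-1%:C + r i.+1) l.
have Su : S \in unitmx.
  apply: evolution_unitmx => //.
  - exact: discLap_mx_sym.
  - by move=> q; exact: discLap_mx_psd.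
  - by move=> i; rewrite ReD; apply: r0; rewrite /= ltnS ltn_ord.
pose b : 'cV_m := \col_i (tau^-1%:C * p i.+1).
have t0 : tau%:C != 0 by rewrite eq_complex/= eqxx andbT gt_eqF.
have eqnP w : (forall j, (0 < j < m.+1)%N ->
       (w j - p j) / (2 * tau)%:C
       + l * discLap alpha h m.+1 (fun k => (w k + p k) / 2) j
       + r j * ((w j + p j) / 2) = 0)
    <-> S *m (\col_i ((w i.+1 + p i.+1) / 2)) = b.
  have E (i : 'I_m) : (w i.+1 - p i.+1) / (2 * tau)%:C
     + l * discLap alpha h m.+1 (fun k => (w k + p k) / 2) i.+1
     + r i.+1 * ((w i.+1 + p i.+1) / 2)
     = (S *m (\col_i ((w i.+1 + p i.+1) / 2)) - b) i 0.
    rewrite !mxE discLapE.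
    under [in RHS]eq_bigr do rewrite [S _ _]mxE [(\col_(_ < _) _) _ _]mxE mulrDl.
    rewrite big_split/= [in RHS](bigD1 i)//= eqxx mulr1n [in RHS]big1 ?addr0; last first.
      by move=> j; rewrite eq_sym => /negbTE ->; rewrite mulr0n mul0r.
    under [in RHS]eq_bigr do rewrite -mulrA; rewrite -mulr_sumr.
    have -> : (2 * tau)%:C = 2 * tau%:C by rewrite rmorphM/= rmorph_nat.
    have -> : tau^-1%:C = (tau%:C)^-1 by rewrite fmorphV.
    by move: (l * _) => X; field; rewrite t0 ?pnatr_eq0.
  split=> [H|H j /andP[j0 jm]].
    apply/eqP; rewrite -subr_eq0; apply/eqP/colP => i.
    have := E i; rewrite (H i.+1); last by rewrite /= ltnS ltn_ord.
    by move=> <-; rewrite [RHS]mxE.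
  case: j j0 jm => // j _ jm; have := E (Ordinal (jm : (j < m)%N)) => /= ->.
  by rewrite H subrr mxE.
split.
  pose y := invmx S *m b.
  (* the node j sits in row j - 1 of the system, which has no boundary rows *)
  exists (fun j => if insub j.-1 is Some i then 2 * y i 0 - p j else 0).
  apply/eqnP; transitivity (S *m y); last by rewrite mulKVmx.
  by congr (_ *m _); apply/colP => i; rewrite mxE /= valK; field.
move=> w w' Hw Hw' j /andP[j0 jm].
have H := (eqnP w).1 Hw; have H' := (eqnP w').1 Hw'.
have : \col_(i < m) ((w i.+1 + p i.+1) / 2)
     = \col_(i < m) ((w' i.+1 + p i.+1) / 2).
  by rewrite -[LHS](mulKmx Su) H -H' mulKmx.
case: j j0 jm => // j _ jm /colP/(_ (Ordinal (jm : (j < m)%N))); rewrite !mxE/=.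
move=> /(mulIf _) E; apply: (addIr (p j.+1)); apply: E.
by rewrite invr_eq0 pnatr_eq0.
Qed.

End Evolution.

(** * Coercivity from the step bound *)

Section Coercivity.
Context {R : realType}.
Local Notation normc := ComplexField.Normc.normc.

Definition reaction_coef (c : coeffs R) (u v : R[i]) : R[i] :=
  (kappa c +i* zeta c) * `|u| ^+ 2 + (delta c +i* beta c) * `|v| ^+ 2
  - (gamma c)%:C.

Lemma reactionE c u v w : reaction c u v w = reaction_coef c u v * w.
Proof. by rewrite /reaction /reaction_coef mulrBl. Qed.

Lemma Re_reaction_coef_gt c (u v : R[i]) (tau C : R) : 0 < tau ->
  (tau%:E < tau_bound c C)%E -> normc u <= C -> normc v <= C ->
  0 < tau^-1 + complex.Re (reaction_coef c u v).
Proof.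
move=> tau0 tauC uC vC.
have n0 (z : R[i]) : 0 <= normc z by case: z => x y; exact: sqrtr_ge0.
have -> : complex.Re (reaction_coef c u v) =
    kappa c * normc u ^+ 2 + delta c * normc v ^+ 2 - gamma c.
  have nE (z : R[i]) : `|z| ^+ 2 = (normc z ^+ 2)%:C by rewrite rmorphXn.
  by rewrite /reaction_coef !nE /= !mulr0 !subr0.
pose K := `|gamma c| + (`|kappa c| + `|delta c|) * `|C| ^+ 2.
have hK : K < tau^-1.
  have K0 : 0 <= K by rewrite addr_ge0// mulr_ge0// ?addr_ge0// exprn_ge0.
  move: tauC; rewrite /tau_bound inver -/K; case: eqP => [->|/eqP Kn0].
    by rewrite invr_gt0.
  rewrite lte_fin => h; rewrite -[K]invrK ltf_pV2// posrE// invr_gt0.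
  by rewrite lt_neqAle eq_sym Kn0.
have uC2 : normc u ^+ 2 <= `|C| ^+ 2.
  by rewrite ler_pXn2r ?nnegrE// (le_trans uC) ?ler_norm.
have vC2 : normc v ^+ 2 <= `|C| ^+ 2.
  by rewrite ler_pXn2r ?nnegrE// (le_trans vC) ?ler_norm.
have mul_ge (k x y : R) : 0 <= x -> x <= y -> - (`|k| * y) <= k * x.
  move=> x0 xy; rewrite lerNl -mulNr.
  apply: le_trans (ler_wpM2l (normr_ge0 k) xy).
  by apply: ler_wpM2r => //; rewrite -normrN ler_norm.
have h1 := mul_ge (kappa c) _ _ (sqr_ge0 (normc u)) uC2.
have h2 := mul_ge (delta c) _ _ (sqr_ge0 (normc v)) vC2.
have h3 := ler_norm (gamma c).
by move: hK; rewrite /K mulrDl; lra.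
Qed.

Lemma le_maxnorm M (w : nat -> R[i]) j :
  (0 < j < M)%N -> normc (w j) <= maxnorm M w.
Proof.
move=> jM; rewrite /maxnorm.
apply: (@le_bigmax_seq _ _ _ _ 0 j xpredT (fun j => normc (w j))) => //.
by rewrite mem_index_iota.
Qed.

End Coercivity.

(** * Solving the scheme level by level *)

Section Gridfun.
Context {R : realType}.

Lemma gval_eq m M (U : gridfun R m M) m' (U' : gridfun R m' M) n n' :
  (forall j, (j <= M)%N -> gval U n j = gval U' n' j) -> gval U n = gval U' n'.
Proof.
move=> H; apply: funext => j.
(* beyond M both sides are read off at the index inord j *)
have := H (inord j : 'I_M.+1); rewrite /gval inord_val.
by apply; rewrite -ltnS.
Qed.

Lemma gval_eq_dirichlet m M (U U' : gridfun R m M) n :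
  gval U n 0 = 0 /\ gval U n M = 0 -> gval U' n 0 = 0 /\ gval U' n M = 0 ->
  (forall j, (0 < j < M)%N -> gval U n j = gval U' n j) -> gval U n = gval U' n.
Proof.
move=> [e0 eM] [e0' eM'] H; apply: gval_eq => j jM.
have [->|j0] := eqVneq j 0%N; first by rewrite e0 e0'.
have [->|jM'] := eqVneq j M; first by rewrite eM eM'.
by apply: H; lia.
Qed.

Lemma gridfun_eq m M (U U' : gridfun R m M) :
  (forall n, (n <= m)%N -> gval U n = gval U' n) -> U = U'.
Proof.
move=> H; apply/matrixP => i j.
have := congr1 (@^~ (j : nat)) (H i (ltn_ord i)).
by rewrite /gval /= !inord_val.
Qed.

Definition gextend m M (U : gridfun R m M) (w : nat -> R[i]) : gridfun R m.+1 M :=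
  \matrix_(i, j)
    if (i <= m)%N then gval U i j else if (0 < j < M)%N then w j else 0.

Lemma gval_gextend m M (U : gridfun R m M) w n : (n <= m)%N ->
  gval (gextend U w) n = gval U n.
Proof.
move=> nm; apply: gval_eq => j jM.
by rewrite {1}/gval mxE !inordK// ?nm// ltnS leqW.
Qed.

Lemma gval_gextendS m M (U : gridfun R m M) w j : (j <= M)%N ->
  gval (gextend U w) m.+1 j = if (0 < j < M)%N then w j else 0.
Proof. by move=> jM; rewrite {1}/gval mxE !inordK// ltnn. Qed.

Definition gstart M (f g : nat -> R[i]) : gridfun R 1 M :=
  \matrix_(i, j) if (0 < j < M)%N then (if i == 0 then f j else g j) else 0.

Lemma gval_gstart M f g n j : (n <= 1)%N -> (j <= M)%N ->
  gval (gstart M f g) n j =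
  if (0 < j < M)%N then (if n == 0%N then f j else g j) else 0.
Proof. by move=> n1 jM; rewrite /gval mxE -val_eqE/= !inordK. Qed.

End Gridfun.

(** The value w1 found for this component at level 1 is the same whatever is
    chosen for the other one (v1 for w = u, u1 for w = v), since the first step
    is explicit; so the two components can be started independently. *)
Lemma component_start (R : realType) (alpha a h tau : R) (c : coeffs R)
    (u0 v0 w0 : R -> R[i]) M :
  exists w1, forall u1 v1, component_scheme alpha a h tau c w0
    (gstart M (fun j => u0 (node a h j)) u1)
    (gstart M (fun j => v0 (node a h j)) v1)
    (gstart M (fun j => w0 (node a h j)) w1).
Proof.
pose at0 (f : R -> R[i]) j := f (node a h j).
exists (fun j => at0 w0 j - tau%:C *
   ((upsilon c +i* eta c) * discLap alpha h M (at0 w0) j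
    + reaction c (at0 u0 j) (at0 v0 j) (at0 w0 j))).
move=> u1 v1.
have g0 f w j : (0 < j < M)%N -> gval (gstart M (at0 f) w) 0 j = at0 f j.
  by move=> jM; rewrite gval_gstart ?jM//; lia.
split.
- by move=> j jM; rewrite g0.
- by move=> n n1; rewrite !gval_gstart// ltnn ltnn andbF.
- move=> j jM; rewrite gval_gstart ?jM//; last lia.
  by rewrite !g0// (eq_discLap _ _ _ (fun k kM => g0 _ _ k kM)).
- by move=> n j; lia.
Qed.

Section Levels.
Context {R : realType} (alpha a h tau : R) (c : coeffs R) (w0 : R -> R[i]) (M : nat).
Context (halpha : 1 < alpha <= 2) (tau0 : 0 < tau) (hups : 0 <= upsilon c).

(** The equation for level m + 1 involves the other component at level m only,
    so the choices wU and wV of the new level are free. *)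
Lemma component_extend m (U V W : gridfun R m M) : (0 < m)%N ->
  (forall j, (0 < j < M)%N ->
     0 < tau^-1 + complex.Re (reaction_coef c (gval U m j) (gval V m j))) ->
  component_scheme alpha a h tau c w0 U V W ->
  exists w, forall wU wV, component_scheme alpha a h tau c w0
    (gextend U wU) (gextend V wV) (gextend W w).
Proof.
move=> m0 r0 [S0 Sb S1 S3].
have [[w hw] _] := linear_step h (l := upsilon c +i* eta c) (gval W m.-1)
  halpha tau0 hups r0.
exists w => wU wV; split.
- by move=> j jM; rewrite gval_gextend// S0.
- move=> n; rewrite leq_eqVlt => /orP[/eqP ->|].
    by rewrite !gval_gextendS// ltnn ltnn andbF.
  by rewrite ltnS => nm; rewrite gval_gextend//; exact: Sb.
- by move=> j jM; rewrite !gval_gextend// S1.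
- move=> n j /andP[n0]; rewrite ltnS leq_eqVlt => /orP[/eqP nm|nm] jM; last first.
    have -> : tdiff tau (gextend W w) n = tdiff tau W n.
      by apply: funext => k; rewrite /tdiff !gval_gextend//; lia.
    have -> : tavg (gextend W w) n = tavg W n.
      by apply: funext => k; rewrite /tavg !gval_gextend//; lia.
    by rewrite !gval_gextend ?(ltnW nm)// S3// n0.
  subst n; rewrite reactionE !gval_gextend// -[RHS](hw j jM).
  have wE k : (0 < k < M)%N -> gval (gextend W w) m.+1 k = w k.
    by move=> kM; rewrite gval_gextendS ?kM//; lia.
  have tE k : (0 < k < M)%N ->
      tavg (gextend W w) m k = (w k + gval W m.-1 k) / 2.
    by move=> kM; rewrite /tavg wE// gval_gextend//; lia.
  rewrite /tdiff wE// [gval _ m.-1]gval_gextend; last lia.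
  by rewrite (eq_discLap _ _ _ tE) tE.
Qed.

Lemma component_unique m n (U V W U' V' W' : gridfun R m M) : (n < m)%N ->
  (forall j, (0 < n)%N -> (0 < j < M)%N ->
     0 < tau^-1 + complex.Re (reaction_coef c (gval U n j) (gval V n j))) ->
  component_scheme alpha a h tau c w0 U V W ->
  component_scheme alpha a h tau c w0 U' V' W' ->
  (forall k, (k <= n)%N -> gval U k = gval U' k) ->
  (forall k, (k <= n)%N -> gval V k = gval V' k) ->
  (forall k, (k <= n)%N -> gval W k = gval W' k) ->
  gval W n.+1 = gval W' n.+1.
Proof.
move=> nm r0 [_ Sb S1 S3] [_ Sb' S1' S3'] EU EV EW.
apply: gval_eq_dirichlet; [exact: Sb | exact: Sb' |].
case: n => [|n] in nm r0 EU EV EW *.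
  by move=> j jM; rewrite S1// S1'// (EU 0)// (EV 0)// (EW 0).
have [_ uni] := linear_step h (l := upsilon c +i* eta c) (gval W n)
  halpha tau0 hups (fun j => r0 j isT).
apply: uni => j jM.
  have := S3 n.+1 j; rewrite reactionE; apply=> //; exact/andP.
have := S3' n.+1 j; rewrite reactionE -EU// -EV// /tdiff /tavg -(EW n)//.
by apply=> //; exact/andP.
Qed.

End Levels.

(** * Unique solvability *)

Theorem theorem3 (R : realType) (alpha T a b : R) (c1 c2 : coeffs R)
    (u0 v0 : R -> R[i]) (u v : R -> R -> R[i]) (tau0 h0 Cstar : R)
    (halpha : 1 < alpha <= 2) (hT : 0 < T) (hab : a < b)
    (hups1 : 0 < upsilon c1) (hups2 : 0 < upsilon c2)
    (husol : exact_solution alpha T a b c1 c2 u0 v0 u v)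
    (husm : smooth T u) (hvsm : smooth T v)
    (htau0 : 0 < tau0) (hh0 : 0 < h0) (hCstar : 0 < Cstar)
    (hconst : convergence_constants alpha T a b c1 c2 u0 v0 u v tau0 h0 Cstar)
    (M N : nat) (hM : (0 < M)%N) (hN : (0 < N)%N)
    (hh : step (b - a) M < h0)
    (htau : ((step T N)%:E <
      mine tau0%:E (mine (tau_bound c1 Cstar) (tau_bound c2 Cstar)))%E) :
  exists! UV : gridfun R N M * gridfun R N M,
    scheme alpha a (step (b - a) M) (step T N) c1 c2 u0 v0 UV.1 UV.2.
Proof.
set h := step (b - a) M in hh *; set tau := step T N in htau *.
have tau_gt0 : 0 < tau by rewrite divr_gt0// ltr0n.
move: htau; rewrite !lt_min lte_fin => /and3P[tau_lt0 tau1 tau2].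
have coercive m (U V : gridfun R m M) n j : (1 <= m <= N)%N ->
    scheme alpha a h tau c1 c2 u0 v0 U V -> (1 <= n <= m)%N -> (0 < j < M)%N ->
    0 < tau^-1 + complex.Re (reaction_coef c1 (gval U n j) (gval V n j)) /\
    0 < tau^-1 + complex.Re (reaction_coef c2 (gval U n j) (gval V n j)).
  move=> hm hUV hn hj; case: hconst => C0 _ H.
  have [_ _ U_le V_le] := H M N hM hN tau_lt0 hh m hm U V hUV n hn.
  have Uj := le_trans (le_maxnorm (gval U n) hj) U_le.
  have Vj := le_trans (le_maxnorm (gval V n) hj) V_le.
  by split; apply: (Re_reaction_coef_gt (C := Cstar)).
have [ups1 ups2] := (ltW hups1, ltW hups2).
have ex m : (m < N)%N ->
    exists U V : gridfun R m.+1 M, scheme alpha a h tau c1 c2 u0 v0 U V.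
  elim: m => [_|m IH mN].
    have [u1 hu] := component_start alpha a h tau c1 u0 v0 u0 M.
    have [v1 hv] := component_start alpha a h tau c2 u0 v0 v0 M.
    by exists (gstart M (fun j => u0 (node a h j)) u1),
              (gstart M (fun j => v0 (node a h j)) v1).
  have [U [V hUV]] := IH (ltnW mN).
  have co j (hj : (0 < j < M)%N) :=
    coercive _ U V m.+1 j (ltnW mN) hUV (ltnSn m) hj.
  have [wU hU] := component_extend halpha tau_gt0 ups1 (ltn0Sn m)
    (fun j hj => (co j hj).1) hUV.1.
  have [wV hV] := component_extend halpha tau_gt0 ups2 (ltn0Sn m)
    (fun j hj => (co j hj).2) hUV.2.
  by exists (gextend U wU), (gextend V wV).
have [U [V hUV]] : exists U V : gridfun R N M, scheme alpha a h tau c1 c2 u0 v0 U V.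
  by case: (N) hN ex => // n _ ex; exact: ex.
exists (U, V); split=> // -[U' V'] /= hUV'.
have eq_levels n : (n <= N)%N ->
    forall k, (k <= n)%N -> gval U k = gval U' k /\ gval V k = gval V' k.
  elim: n => [_ k|n IH nN k].
    rewrite leqn0 => /eqP ->.
    case: hUV hUV' => [[U0 Ub _ _] [V0 Vb _ _]] [[U0' Ub' _ _] [V0' Vb' _ _]].
    split; apply: gval_eq_dirichlet.
    - exact: Ub.
    - exact: Ub'.
    - by move=> j hj; rewrite U0// U0'.
    - exact: Vb.
    - exact: Vb'.
    - by move=> j hj; rewrite V0// V0'.
  rewrite leq_eqVlt => /orP[/eqP ->|]; last by rewrite ltnS; exact: IH (ltnW nN) k.
  have EU k' hk := (IH (ltnW nN) k' hk).1.
  have EV k' hk := (IH (ltnW nN) k' hk).2.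
  have co j (n0 : (0 < n)%N) (hj : (0 < j < M)%N) :
      0 < tau^-1 + complex.Re (reaction_coef c1 (gval U n j) (gval V n j)) /\
      0 < tau^-1 + complex.Re (reaction_coef c2 (gval U n j) (gval V n j)).
    by apply: (coercive N) => //; rewrite ?hN ?n0//= ltnW.
  split.
    exact: (component_unique halpha tau_gt0 ups1 nN
      (fun j n0 hj => (co j n0 hj).1) hUV.1 hUV'.1).
  exact: (component_unique halpha tau_gt0 ups2 nN
    (fun j n0 hj => (co j n0 hj).2) hUV.2 hUV'.2).
by congr pair; apply: gridfun_eq => n nN; have [] := eq_levels _ nN n (leqnn n).
Qed.
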